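(* Let $G = (V, E)$ be a graph and let $X\subseteq V$. Then there exists a stable set $X'\subseteq X$ such that $$\vert X' \vert \geq \vert X \vert - \vert E(G[X]) \vert.$$ The computation of such a set $X'$ can be done in $\mathcal{O}( \vert E(G[X]) \vert + \vert V(G[X]) \vert)$ time.
   Context: Graphs are finite, simple and undirected. A stable set is a subset of pairwise non-adjacent vertices. For $X \subseteq V$, $G[X]$ denotes the subgraph of $G$ induced by $X$, with vertex set $V(G[X]) = X$ and edge set $E(G[X])$. *)

(* Defs.v *)
From mathcomp Require Import all_boot.

Set Implicit Arguments.
Unset Strict Implicit.
Unset Printing Implicit Defensive.

(* The vertex set of a graph is a finite set of elements of an
   ambient type T, so that G and G[X] are graphs over the same type and
   V(G[X]) is X itself. *)
Record sgraph (T : finType) := SGraph {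
  vertices : {set T};
  edges : {set {set T}};
  edgesP : forall e, e \in edges -> e \subset vertices /\ #|e| = 2
}.

Definition adjacent (T : finType) (G : sgraph T) (u v : T) : bool :=
  [set u; v] \in edges G.

Lemma induced_edgesP (T : finType) (G : sgraph T) (X : {set T}) (e : {set T}) :
  e \in [set e in edges G | e \subset X] -> e \subset X /\ #|e| = 2.
Proof. by rewrite inE => /andP[/edgesP[_ e2] eX]. Qed.

Definition induced (T : finType) (G : sgraph T) (X : {set T}) : sgraph T :=
  SGraph (@induced_edgesP T G X).

Definition stable (T : finType) (G : sgraph T) (S : {set T}) : bool :=
  (S \subset vertices G) &&
  [forall u in S, forall v in S, ~~ adjacent G u v].

(* Running time is measured on the random access machine of Cook and Reckhow,
   with uniform cost: registers hold natural numbers (subtraction is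
   truncated), the input is read from a tape (0 past its end), the output is
   printed on another tape, and each executed instruction costs one unit.
   There is deliberately no multiplication, so that unit cost is realistic. *)
Inductive instr :=
  | IConst of nat & nat         (* X_i <- c *)
  | IAdd of nat & nat & nat     (* X_i <- X_j + X_k *)
  | ISub of nat & nat & nat     (* X_i <- X_j - X_k *)
  | IFetch of nat & nat         (* X_i <- X_(X_j) *)
  | IStore of nat & nat         (* X_(X_i) <- X_j *)
  | IJpos of nat & nat          (* if X_j > 0 goto m *)
  | IRead of nat                (* X_i <- next input *)
  | IPrint of nat.              (* output X_i *)

Definition program := seq instr.

Record config := Config {
  pc : nat;
  reg : nat -> nat;
  inp : seq nat;
  out : seq nat
}.

Definition upd (r : nat -> nat) (i v : nat) : nat -> nat :=
  fun k => if k == i then v else r k.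

Definition exec (i : instr) (s : config) : config :=
  let: Config l r x y := s in
  match i with
  | IConst i c => Config l.+1 (upd r i c) x y
  | IAdd i j k => Config l.+1 (upd r i (r j + r k)) x y
  | ISub i j k => Config l.+1 (upd r i (r j - r k)) x y
  | IFetch i j => Config l.+1 (upd r i (r (r j))) x y
  | IStore i j => Config l.+1 (upd r (r i) (r j)) x y
  | IJpos j m => Config (if 0 < r j then m else l.+1) r x y
  | IRead i => Config l.+1 (upd r i (head 0 x)) (behead x) y
  | IPrint i => Config l.+1 r x (rcons y (r i))
  end.

Definition halted (p : program) (s : config) : bool := size p <= pc s.

Definition step (p : program) (s : config) : config :=
  if onth p (pc s) is Some i then exec i s else s.

Definition init (x : seq nat) : config := Config 0 (fun _ => 0) x [::].

(* As step is the identity on halted configurations, this says that p halts on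
   input x with output y after at most t steps. *)
Definition computes_within (p : program) (x y : seq nat) (t : nat) : Prop :=
  let s := iter t (step p) (init x) in halted p s /\ out s = y.

(* s lists the vertices, a vertex being represented by its index in s, and a
   gives the adjacency list of each vertex, in an arbitrary order. *)
Definition adjacency_lists (T : finType) (G : sgraph T)
    (s : seq T) (a : T -> seq T) : Prop :=
  [/\ uniq s, s =i vertices G &
      forall v, v \in vertices G -> uniq (a v) /\ a v =i adjacent G v].

Definition encode_graph (T : finType) (s : seq T) (a : T -> seq T) : seq nat :=
  size s ::
  flatten [seq size (a v) :: [seq index u s | u <- a v] | v <- s].

(* y lists the indices of the elements of S, each once, in any order. *)
Definition encodes_set (T : finType) (s : seq T) (S : {set T}) (y : seq nat) :
  bool := perm_eq y [seq index v s | v <- enum S].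

(* Main.v *)
(* Order the vertices of H = G[X] and keep those with no smaller neighbour.  Two
   kept vertices cannot be adjacent, and mapping each discarded vertex v to an
   edge joining v to a smaller neighbour is injective, because v is the larger
   end of that edge; so at most |E(H)| vertices are discarded.  With the order
   of the input, whether v is kept depends only on the adjacency list of v, so
   a single pass over the input, using constantly many registers, suffices. *)
Require Import Defs.
From mathcomp Require Import all_boot.
From mathcomp Require Import zify.

Set Implicit Arguments.
Unset Strict Implicit.
Unset Printing Implicit Defensive.

(** * Degree sums and local minima of a graph *)

Lemma adjacent_neq (T : finType) (G : sgraph T) (u v : T) :
  adjacent G u v -> u != v.
Proof.
by move=> /edgesP[_]; rewrite cards2; case: (u =P v).
Qed.

Lemma adjacentC (T : finType) (G : sgraph T) (u v : T) :
  adjacent G u v = adjacent G v u.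
Proof. by rewrite /adjacent setUC. Qed.

(** Double counting of incident pairs: the neighbours [u] of [v] inject into the edges at [v] by
    forming [[set v; u]], and an edge has two ends. This will bound the total length of the
    adjacency lists. *)
Lemma sum_degrees (T : finType) (G : sgraph T) :
  \sum_(v in vertices G) #|adjacent G v| <= 2 * #|edges G|.
Proof.
have deg v : #|adjacent G v| <= \sum_(e in edges G) (v \in e).
  rewrite -big_mkcondr sum1_card /=.
  have inj : {in adjacent G v &, injective (fun u => [set v; u])}.
    move=> u w vu _ /setP/(_ u); rewrite !inE eqxx orbT.
    by rewrite eq_sym (negPf (adjacent_neq vu)) => /esym/eqP.
  rewrite -(card_in_imset inj); apply/subset_leq_card/subsetP=> e.
  by case/imsetP=> u vu ->; apply/andP; split; [exact: vu | exact: set21].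
apply: leq_trans (leq_sum _ (fun v _ => deg v)) _.
rewrite exchange_big /= mulnC -sum_nat_const; apply: leq_sum => e /edgesP[_ <-].
rewrite -big_mkcondr sum1_card /=; apply/subset_leq_card/subsetP=> v.
by case/andP.
Qed.

(** The comparison is not strict because the program tests that a truncated subtraction gives 0;
    stability therefore asks [r] to be injective. *)
Definition local_minima (T : finType) (G : sgraph T) (r : T -> nat) : {set T} :=
  [set v in vertices G | [forall u in adjacent G v, r v <= r u]].

Section LocalMinima.

Variables (T : finType) (G : sgraph T) (r : T -> nat).

Lemma stable_local_minima :
  {in vertices G &, injective r} -> stable G (local_minima G r).
Proof.
move=> r_inj; apply/andP; split.
  by apply/subsetP=> v; rewrite inE => /andP[].
apply/forall_inP=> u; rewrite inE => /andP[uG /forall_inP minu].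
apply/forall_inP=> v; rewrite inE => /andP[vG /forall_inP minv].
apply/negP=> uv; have vu : adjacent G v u by rewrite adjacentC.
have /eqP := adjacent_neq uv; apply; apply: r_inj => //.
by apply/eqP; rewrite eqn_leq minu // minv.
Qed.

Lemma card_local_minima :
  #|vertices G| - #|edges G| <= #|local_minima G r|.
Proof.
pose D := vertices G :\: local_minima G r.
(* The default [v] is never taken on [D]: a discarded vertex has a smaller neighbour. *)
pose low v := odflt v [pick u in adjacent G v | r u < r v].
have lowP v : v \in D -> adjacent G v (low v) && (r (low v) < r v).
  rewrite !inE negb_and => /andP[/orP[/negP //|/forall_inPn[u vu]]] + vG.
  rewrite -ltnNge => lt_uv; rewrite /low; case: pickP => [w //|/(_ u)].
  by rewrite vu lt_uv.
have inj : {in D &, injective (fun v => [set v; low v])}.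
  (* If the two edges agree while [v != w], then [v = low w] and [w = low v], so
     [r v < r w < r v]. *)
  move=> v w /lowP/andP[_ ltv] /lowP/andP[_ ltw] /setP eq_vw.
  move: (eq_vw v) (eq_vw w); rewrite !inE !eqxx /=.
  move=> /esym/orP[/eqP //|/eqP vw] /orP[/eqP //|/eqP wv].
  by move: ltv ltw; rewrite -wv -vw; lia.
have : #|D| <= #|edges G|.
  rewrite -(card_in_imset inj); apply/subset_leq_card/subsetP=> e.
  by case/imsetP=> v /lowP/andP[vlow _] ->.
have sub : local_minima G r \subset vertices G.
  by apply/subsetP=> v; rewrite inE => /andP[].
by have := subset_leq_card sub; rewrite cardsDS //; lia.
Qed.

End LocalMinima.

Lemma stable_induced (T : finType) (G : sgraph T) (X S : {set T}) :
  X \subset vertices G -> stable (induced G X) S -> stable G S.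
Proof.
move=> XG /andP[/= SX /forall_inP stS]; rewrite /stable (subset_trans SX XG) /=.
apply/forall_inP=> u uS; apply/forall_inP=> v vS.
have /forall_inP/(_ v vS) := stS u uS; apply: contra => uv.
by rewrite /adjacent inE -/(adjacent G u v) uv subUset !sub1set !(subsetP SX).
Qed.

(** * Execution of the register program *)

Lemma iter_halted (p : program) (s : config) (n : nat) :
  halted p s -> iter n (step p) s = s.
Proof.
move=> hs; elim: n => //= n ->; rewrite /step.
suff -> : onth p (pc s) = None by [].
by apply: onth_default.
Qed.

(* X_0 counts the vertices left, X_1 is the current vertex, X_2 counts the
   neighbours left, and X_4 sums X_1 - u over the neighbours u read so far: by
   truncation it stays 0 exactly when none of them is smaller than X_1.
   X_5 = 1 turns IJpos into an unconditional jump. *)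
Definition minima_prog : program :=
  [:: IRead 0;
      IConst 5 1;
      (* 2: next vertex *)
      IJpos 0 4;
      IJpos 5 18;
      IRead 2;
      IConst 4 0;
      (* 6: next neighbour *)
      IJpos 2 8;
      IJpos 5 13;
      IRead 3;
      ISub 3 1 3;
      IAdd 4 4 3;
      ISub 2 2 5;
      IJpos 5 6;
      (* 13: end of the adjacency list *)
      IJpos 4 15;
      IPrint 1;
      IAdd 1 1 5;
      ISub 0 0 5;
      IJpos 5 2].

(** Each neighbour costs six instructions and leaving the loop costs two. Only the positivity of
    register 4 is tracked, as the later jump tests nothing else. *)
Lemma run_neighbours (d : seq nat) (r : nat -> nat) (x y : seq nat) :
  r 2 = size d -> r 5 = 1 ->
  exists r',
    [/\ iter (6 * size d + 2) (step minima_prog) (Config 6 r (d ++ x) y)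
          = Config 13 r' x y,
        r' 0 = r 0, r' 1 = r 1, r' 5 = 1 &
        (0 < r' 4) = (0 < r 4) || ~~ all (leq (r 1)) d].
Proof.
elim: d r => [|u d IHd] r r2 r5.
  by exists r; split; rewrite ?orbF //= /step /= r2 /= r5.
pose r1 :=
  upd (upd (upd (upd r 3 u) 3 (r 1 - u)) 4 (r 4 + (r 1 - u))) 2 (size d).
have start : iter 6 (step minima_prog) (Config 6 r (u :: d ++ x) y)
    = Config 6 r1 (d ++ x) y.
  by rewrite /= /step /= r2 /= /upd /= r5 /= r2 subn1.
have [//|//|r' [run e0 e1 e5 e4]] := IHd r1.
exists r'; split=> //; last first.
  by rewrite e4 /r1 /upd /= addn_gt0 subn_gt0 -orbA negb_and -ltnNge.
have -> : 6 * size (u :: d) + 2 = 6 * size d + 2 + 6 by rewrite /=; lia.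
by rewrite iterD start run.
Qed.

(** A vertex costs 3 steps to enter, [6 * size d + 2] for its list and at most 5 to leave, hence the
    10; the final 2 end the outer loop. Starting [iota] at [r 1] lets the induction go through. *)
Lemma run_vertices (ds : seq (seq nat)) (r : nat -> nat) (y : seq nat) :
  r 0 = size ds -> r 5 = 1 ->
  exists t r',
    t <= 10 * size ds + 6 * sumn (map size ds) + 2 /\
    iter t (step minima_prog)
        (Config 2 r (flatten [seq size d :: d | d <- ds]) y)
      = Config 18 r' [::]
          (y ++ unzip1 [seq b <- zip (iota (r 1) (size ds)) ds
                                 | all (leq b.1) b.2]).
Proof.
elim: ds r y => [|d ds IHds] r y r0 r5.
  by exists 2, r; split=> //; rewrite /= /step /= r0 /= r5 /= cats0.
pose r1 := upd (upd r 2 (size d)) 4 0.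
have [//|//|r2 [run e0 e1 e5 e4]] :=
  @run_neighbours d r1 (flatten [seq size d :: d | d <- ds]) y.
pose r3 := upd (upd r2 1 (r 1).+1) 0 (size ds).
pose y' := if all (leq (r 1)) d then rcons y (r 1) else y.
have [//|//|t [r' [le_t run']]] := IHds r3 y'.
have start : iter 3 (step minima_prog)
    (Config 2 r (size d :: d ++ flatten [seq size d :: d | d <- ds]) y)
  = Config 6 r1 (d ++ flatten [seq size d :: d | d <- ds]) y.
  by rewrite /= /step /= r0.
have [k [le_k finish]] : exists k, k <= 5 /\
  iter k (step minima_prog)
      (Config 13 r2 (flatten [seq size d :: d | d <- ds]) y)
    = Config 2 r3 (flatten [seq size d :: d | d <- ds]) y'.
  have r3E : r3 = upd (upd r2 1 (r2 1 + r2 5)) 0 (r2 0 - r2 5).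
    by rewrite e0 e1 e5 /r1 /upd /= r0 addn1 subn1.
  (* A discarded vertex skips [IPrint], which saves one step. *)
  move: e4; rewrite /r1 /= /y' r3E; case: all => /= e4; [exists 5 | exists 4].
    by split=> //; rewrite /= /step /= e4 /= /upd /= e5 e1.
  by split=> //; rewrite /= /step /= e4 /= /upd /= e5.
exists (t + (k + (6 * size d + 2 + 3))), r'; split; first by rewrite /=; lia.
rewrite iterD iterD [X in iter _ _ (iter _ _ X)]iterD start run finish run'.
by rewrite /r3 /upd /= /y'; case: all; rewrite //= cat_rcons.
Qed.

Lemma minima_prog_computes (ds : seq (seq nat)) :
  computes_within minima_prog
    (size ds :: flatten [seq size d :: d | d <- ds])
    (unzip1 [seq b <- zip (iota 0 (size ds)) ds | all (leq b.1) b.2])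
    (10 * size ds + 6 * sumn (map size ds) + 4).
Proof.
pose r := upd (upd (fun=> 0) 0 (size ds)) 5 1.
have [//|//|t [r' [le_t run]]] := @run_vertices ds r [::].
rewrite /computes_within.
(* Two instructions precede the outer loop, hence [t + 2]; the remaining steps are spent in the
   halted configuration. *)
have -> : 10 * size ds + 6 * sumn (map size ds) + 4
    = (10 * size ds + 6 * sumn (map size ds) + 2 - t) + (t + 2) by lia.
rewrite iterD [X in iter _ _ X]iterD [X in iter _ _ (iter _ _ X)]/= run.
by rewrite iter_halted.
Qed.

(** * Correctness and time bound on encoded graphs *)

Lemma map_index_uniq (T : eqType) (s : seq T) :
  uniq s -> [seq index v s | v <- s] = iota 0 (size s).
Proof.
case: s => // v0 s s_uniq.
apply: (@eq_from_nth _ 0); rewrite size_map ?size_iota // => i lt_i.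
by rewrite nth_iota // (nth_map v0) // index_uniq.
Qed.

Section AdjacencyLists.

Variables (T : finType) (G : sgraph T) (s : seq T) (a : T -> seq T).
Hypothesis sa : adjacency_lists G s a.

Let rank v := index v s.

Lemma rank_inj : {in vertices G &, injective rank}.
Proof.
case: sa => _ sG _ u v; rewrite -!sG => us vs eq_r.
by rewrite -(nth_index u us) -(nth_index u vs) -!/(rank _) eq_r.
Qed.

Lemma sum_size_adjacency :
  sumn [seq size (a v) | v <- s] <= 2 * #|edges G|.
Proof.
case: sa => s_uniq sG aG; apply: leq_trans (sum_degrees G).
rewrite sumnE big_map -(eq_bigl _ _ sG) -big_uniq //=.
rewrite big_seq [X in _ <= X]big_seq.
apply: leq_sum => v; rewrite sG => /aG[av_uniq av].
by rewrite -(card_uniqP av_uniq) (eq_card av).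
Qed.

Lemma minima_prog_local_minima :
  exists y, encodes_set s (local_minima G rank) y /\
    computes_within minima_prog (encode_graph s a) y
      (12 * (#|edges G| + #|vertices G|).+1).
Proof.
case: (sa) => s_uniq sG aG.
have sizeV : size s = #|vertices G|.
  by rewrite -(card_uniqP s_uniq); apply: eq_card.
pose ds := [seq [seq rank u | u <- a v] | v <- s].
have size_ds : map size ds = [seq size (a v) | v <- s].
  by rewrite /ds -map_comp; apply: eq_map => v /=; rewrite size_map.
exists (unzip1 [seq b <- zip (iota 0 (size ds)) ds | all (leq b.1) b.2]); split.
  (* The vertex counter runs through the indices of [s] in order, so the output is the image under
     [index] of a filtered [s]. *)
  rewrite size_map -map_index_uniq //.
  rewrite /ds zip_map filter_map /unzip1 -map_comp /encodes_set.
  apply: perm_map; apply: uniq_perm => [||v];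
    rewrite ?enum_uniq ?filter_uniq //.
  rewrite mem_filter mem_enum sG [RHS]inE andbC /= all_map.
  have [vG|//] := boolP (v \in vertices G); have [_ av] := aG v vG.
  rewrite /=; apply/allP/forall_inP => min_v u vu; apply: min_v.
    by rewrite av.
  by rewrite -av.
have -> : encode_graph s a = size ds :: flatten [seq size d :: d | d <- ds].
  rewrite /encode_graph /ds size_map -map_comp; congr (_ :: flatten _).
  by apply: eq_map => v /=; rewrite size_map.
have [] := minima_prog_computes ds; set t := (X in iter X).
(* The lists have at most [2 * #|edges G|] entries in all, at 6 steps each, whence 12; this also
   covers 10 steps per vertex and the constant 4. *)
have -> : 12 * (#|edges G| + #|vertices G|).+1
    = (12 * (#|edges G| + #|vertices G|).+1 - t) + t.
  have := sum_size_adjacency; rewrite /t size_ds size_map sizeV; lia.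
by move=> ht <-; rewrite /computes_within iterD iter_halted.
Qed.

End AdjacencyLists.

Theorem proposition5 :
  (forall (T : finType) (G : sgraph T) (X : {set T}),
     X \subset vertices G ->
     exists X' : {set T},
       [/\ X' \subset X, stable G X' &
           #|X'| >= #|X| - #|edges (induced G X)|])
  /\
  (exists (p : program) (c : nat),
     forall (T : finType) (G : sgraph T) (X : {set T}),
       X \subset vertices G ->
       forall (s : seq T) (a : T -> seq T),
         adjacency_lists (induced G X) s a ->
         exists (X' : {set T}) (y : seq nat),
           [/\ X' \subset X, stable G X',
               #|X'| >= #|X| - #|edges (induced G X)|,
               encodes_set s X' y &
               computes_within p (encode_graph s a) y
                 (c * (#|edges (induced G X)|
                       + #|vertices (induced G X)|).+1)]).
Proof.
(* Both halves take local minima of [induced G X] and differ only in the ranking: [enum_rank] for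
   existence, the position in [s] for the computation. *)
have minima (T : finType) G (X : {set T}) (r : T -> nat) :
    X \subset vertices G ->
    {in X &, injective r} -> let S := local_minima (induced G X) r in
  [/\ S \subset X, stable G S & #|S| >= #|X| - #|edges (induced G X)|].
  move=> XG r_inj S; have stS : stable (induced G X) S.
    exact: stable_local_minima.
  split; [by case/andP: stS | exact: stable_induced stS |].
  exact: (card_local_minima (induced G X) r).
split=> [T G X XG|].
  exists (local_minima (induced G X) (fun v => enum_rank v)).
  by apply: minima => // u v _ _ /val_inj/enum_rank_inj.
exists minima_prog, 12 => T G X XG s a sa.
have [y [ySet run]] := minima_prog_local_minima sa.
have [? ? ?] := minima T G X _ XG (rank_inj sa).
by exists (local_minima (induced G X) (fun v => index v s)), y.
Qed.
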